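(* Let $V$ be the evaluation function of a weighted separable attribute model with utility function $u$ and weight function $w$, and let $u^{0}(t)=u(t)w(t,0)$ for $t\in\mathbb{R}$. Suppose the model satisfies (Injective): for all real $t>s>0$, $u^{0}(t)\neq u^{0}(s)$; and (Symmetry): for all real $t>0$, $u^{0}(t)=-u^{0}(-t)$. Then: 1. If the subject ignores the initial endowment, then p-MPL accurately elicits quality, that is, for all real $q>0$ and $p^{*}>0$, $$V((q,-p^{*})|\{(q,-p^{*}),(0,0)\})=V((0,0)|\{(0,0),(q,-p^{*})\})\quad\text{if and only if}\quad q=p^{*}.$$ 2. If the subject treats the initial endowment separately from price and quality, then p-MPL accurately elicits quality, that is, for all real $q>0$, $p^{*}>0$ and $E>0$, $$V((q,-p^{*},E)|\{(q,-p^{*},E),(0,0,E)\})=V((0,0,E)|\{(0,0,E),(q,-p^{*},E)\})\quad\text{if and only if}\quad q=p^{*}.$$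
   Context: An alternative is a vector $x=(x_{1},\dots,x_{N})\in\mathbb{R}^{N}$ of attribute values. A utility function is a weakly increasing function $u:\mathbb{R}\to\mathbb{R}$ with $u(0)=0$ (and $|u(t)|<\infty$ for all $t\in\mathbb{R}$). A weight function is any function $w:\mathbb{R}\times\mathbb{R}\to\mathbb{R}_{+}=[0,\infty)$ (with $w(t,s)<\infty$ for all $t,s\in\mathbb{R}$). A weighted separable attribute model, given by $u$ and $w$ (the same $u$ and $w$ for all attributes), evaluates an alternative $x$ in a binary menu $\{x,y\}$, where $x,y\in\mathbb{R}^{N}$ satisfy $x_{n}y_{n}\geq 0$ for all $n$, by $$V(x|\{x,y\})=\sum_{n=1}^{N}u(x_{n})\,w(x_{n},y_{n}).$$ In $V(x|\{x,y\})$, $x$ is the evaluated alternative and $y$ the comparison alternative, so $V(y|\{y,x\})=\sum_{n=1}^{N}u(y_{n})\,w(y_{n},x_{n})$. In the p-MPL (multiple price list) decision problem a subject endowed with money $E$ chooses between buying a product of subjective quality $q$ at price $p$ and doing nothing. If the subject ignores the endowment, these are represented as $(q,-p)$ and $(0,0)$ (attributes: quality, price); if the subject treats the endowment as a separate attribute, as $(q,-p,E)$ and $(0,0,E)$ (attributes: quality, price, endowment). The switch point $p^{*}$ is the price at which the two alternatives have equal evaluation; p-MPL accurately elicits quality when the quality equals the switch point, which is the displayed equivalence in each case. *)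

(* Defs.v *)
From mathcomp Require Import all_boot all_order all_algebra.
From mathcomp Require Import reals.

Set Implicit Arguments.
Unset Strict Implicit.
Unset Printing Implicit Defensive.

Import Order.TTheory GRing.Theory Num.Theory.
Local Open Scope ring_scope.

Definition utility_function (R : realType) (u : R -> R) : Prop :=
  {homo u : s t / s <= t} /\ u 0 = 0.

Definition weight_function (R : realType) (w : R -> R -> R) : Prop :=
  forall t s : R, 0 <= w t s.

(* V(x|{x,y}): x is the evaluated alternative, y the comparison alternative.
   The model evaluates only menus with x_n * y_n >= 0 for every n; V extends
   the same formula to all pairs x, y. *)
Definition V (R : realType) (u : R -> R) (w : R -> R -> R) (N : nat)
    (x y : 'rV[R]_N) : R :=
  \sum_(n < N) u (x 0 n) * w (x 0 n) (y 0 n).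

Definition u0 (R : realType) (u : R -> R) (w : R -> R -> R) (t : R) : R :=
  u t * w t 0.

Definition injective_condition (R : realType) (u : R -> R) (w : R -> R -> R) :
    Prop :=
  forall s t : R, 0 < s -> s < t -> u0 u w t <> u0 u w s.

Definition symmetry_condition (R : realType) (u : R -> R) (w : R -> R -> R) :
    Prop :=
  forall t : R, 0 < t -> u0 u w t = - u0 u w (- t).

Definition alternative (R : realType) (N : nat) (x : N.-tuple R) : 'rV[R]_N :=
  \row_n tnth x n.

(* Main.v *)
Require Import Defs.
From mathcomp Require Import all_boot all_order all_algebra.
From mathcomp Require Import reals.

Import Order.TTheory GRing.Theory Num.Theory.
Local Open Scope ring_scope.

(** An attribute compared with 0 contributes its [u0] value, and an attribute equal to 0 contributes
    nothing since [u 0 = 0]. A separate endowment adds the same term to both evaluations and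
    cancels. Either way, indifference means [u0 u w q + u0 u w (- p) = 0], which
    [quality_price_balance] solves: symmetry turns it into [u0 u w q = u0 u w p], and injectivity on
    positive reals gives [q = p]. *)

Lemma u0_inj_pos (R : realType) (u : R -> R) (w : R -> R -> R) (q p : R) :
  injective_condition u w -> 0 < q -> 0 < p -> u0 u w q = u0 u w p -> q = p.
Proof.
move=> hinj q0 p0 e; case: (ltgtP q p) => // lt_qp.
- by case: (hinj q p q0 lt_qp).
- by case: (hinj p q p0 lt_qp).
Qed.

Lemma quality_price_balance (R : realType) (u : R -> R) (w : R -> R -> R)
    (q p : R) :
  injective_condition u w -> symmetry_condition u w -> 0 < q -> 0 < p ->
  u0 u w q + u0 u w (- p) = 0 <-> q = p.
Proof.
move=> hinj hsym q0 p0; split=> [/eqP|->].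
- by rewrite addr_eq0 -hsym // => /eqP; apply: u0_inj_pos.
- by rewrite hsym // addNr.
Qed.

Theorem corollary2 (R : realType) (u : R -> R) (w : R -> R -> R)
    (hu : utility_function u) (hw : weight_function w)
    (hinj : injective_condition u w) (hsym : symmetry_condition u w) :
  (forall q p : R, 0 < q -> 0 < p ->
     let buy := alternative [tuple q; - p] in
     let nothing := alternative [tuple 0; 0] in
     V u w buy nothing = V u w nothing buy <-> q = p) /\
  (forall q p E : R, 0 < q -> 0 < p -> 0 < E ->
     let buy := alternative [tuple q; - p; E] in
     let nothing := alternative [tuple 0; 0; E] in
     V u w buy nothing = V u w nothing buy <-> q = p).
Proof.
case: hu => _ u_0; split=> [q p q0 p0|q p E q0 p0 _] /=.
(* Here the weights are [w 0 q] and [w 0 (- p)], about which nothing is known; the factor [u 0 = 0]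
   removes them. *)
- have -> : V u w (alternative [tuple 0; 0]) (alternative [tuple q; - p]) = 0.
    by rewrite /V !big_ord_recl big_ord0 !mxE !(tnth_nth 0) /= u_0 !mul0r !addr0.
  have -> : V u w (alternative [tuple q; - p]) (alternative [tuple 0; 0])
      = u0 u w q + u0 u w (- p).
    by rewrite /V !big_ord_recl big_ord0 !mxE !(tnth_nth 0) /= addr0.
  exact: quality_price_balance.
(* The endowment is compared with itself, so its term is [u E * w E E] rather than [u0 u w E],
   identically for both options. *)
- have -> : V u w (alternative [tuple 0; 0; E]) (alternative [tuple q; - p; E])
      = u E * w E E.
    by rewrite /V !big_ord_recl big_ord0 !mxE !(tnth_nth 0) /= u_0 !mul0r !add0r
               addr0.
  have -> : V u w (alternative [tuple q; - p; E]) (alternative [tuple 0; 0; E])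
      = u0 u w q + u0 u w (- p) + u E * w E E.
    by rewrite /V !big_ord_recl big_ord0 !mxE !(tnth_nth 0) /= addr0 addrA.
  (* What remains is to cancel the common endowment term. *)
  apply: iff_trans (quality_price_balance _ _ _ _ _ hinj hsym q0 p0).
  split=> [|->].
  + by rewrite -[RHS]add0r => /addIr.
  + by rewrite add0r.
Qed.
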